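(* Let $q>3$ be an odd prime power, let $G:=\mathrm{PSL}_2(q)$, and let $\mathscr{C}_1,\mathscr{C}_2$ be the two distinct unipotent conjugacy classes in $G$. (1) If $q\equiv 1 \pmod 4$, then $$\mathscr{C}_1\mathscr{C}_2=\{\text{unipotent elements}\}\cup\{\text{non-split semisimple elements}\}\cup\{\text{split semisimple elements of }q\text{-bad order}\}.$$ (2) If $q\equiv 3\pmod 4$, then $$\mathscr{C}_1\mathscr{C}_2=\{\text{unipotent elements}\}\cup\{\text{split semisimple elements}\}\cup\{\text{non-split semisimple elements of }q\text{-bad order}\}\cup\{1\}.$$
   Context: $\mathrm{PSL}_2(q)=\mathrm{SL}_2(\mathbb{F}_q)/\{\pm I\}$, and $\bar x$ is the image of $x\in\mathrm{SL}_2(q)$. Unipotent elements of $\mathrm{PSL}_2(q)$ are images of non-identity unipotent elements (the identity is not counted). Semisimple elements are images $\bar x$ of non-central semisimple $x\in \mathrm{SL}_2(q)$; $\bar x$ is split if $x$ is diagonalizable over $\mathbb{F}_q$, and non-split if the characteristic polynomial of $x$ is irreducible over $\mathbb{F}_q$. Let $\bar x$ be semisimple of order $t=|\bar x|$ in $\mathrm{PSL}_2(q)$. If $x$ is split, $\bar x$ is of $q$-good order if $t$ is odd and $t\mid q-1$, or $t$ is even and $4t\mid q-1$. If $x$ is non-split, $\bar x$ is of $q$-good order if $t$ is odd and $t\mid q+1$, or $t$ is even and $4t\mid q+1$. $\bar x$ is of $q$-bad order if it is not of $q$-good order. $\mathscr{C}_1\mathscr{C}_2=\{ab:a\in\mathscr{C}_1,b\in\mathscr{C}_2\}$.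 *)

(* Defs.v *)
From HB Require Import structures.
From mathcomp Require Import all_boot all_order all_algebra all_fingroup all_solvable all_field.

Set Implicit Arguments.
Unset Strict Implicit.
Unset Printing Implicit Defensive.

Import GRing.Theory.
Local Open Scope ring_scope.

Section PSL2.

Variable F : finFieldType.

Definition SL2 : {set {'GL_2[F]}} := [set x | \det (GLval x) == 1].

Lemma group_set_SL2 : group_set SL2.
Proof.
apply/group_setP; split=> [|x y]; first by rewrite inE GL_1E det1.
by rewrite !inE GL_ME det_mulmx => /eqP-> /eqP->; rewrite mulr1.
Qed.

Canonical SL2_group := Group group_set_SL2.

Definition pmI : {set {'GL_2[F]}} := [set x | GLval x \in [:: 1; -1]].

Lemma group_set_pmI : group_set pmI.
Proof.
apply/group_setP; split=> [|x y]; first by rewrite !inE GL_1E eqxx.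
rewrite !inE GL_ME.
by case/orP=> /eqP-> /orP[]/eqP->;
  rewrite ?mul1r ?mulr1 ?mulrNN ?mulr1 ?mulN1r ?eqxx ?orbT.
Qed.

Canonical pmI_group := Group group_set_pmI.

(* pmI is central, so coset_of pmI is the quotient of the whole of GL_2; all
   the predicates below only hold for elements of its subgroup PSL2. *)
Definition PSL2 : {group coset_of pmI} := (SL2 / pmI)%G.

Definition unipotent_mx (A : 'M[F]_2) : Prop :=
  exists n : nat, (A - 1) ^+ n = 0.

(* Diagonalizability over a finite extension is the same as over an algebraic
   closure, all eigenvalues and eigenvectors being defined over the former. *)
Definition semisimple_mx (A : 'M[F]_2) : Prop :=
  exists L : fieldExtType F, diagonalizable (map_mx (in_alg L) A).

Implicit Types (g : coset_of pmI) (C : {set coset_of pmI}).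

Definition unipotent g : Prop :=
  exists x : {'GL_2[F]},
    [/\ x \in SL2, x != 1%g, unipotent_mx (GLval x) & g = coset pmI x].

Definition semisimple_image (P : 'M[F]_2 -> Prop) g : Prop :=
  exists x : {'GL_2[F]},
    [/\ x \in SL2, x \notin 'Z(SL2)%g, semisimple_mx (GLval x),
        P (GLval x) & g = coset pmI x].

Definition semisimple g : Prop := semisimple_image (fun=> True) g.

Definition split_semisimple g : Prop :=
  semisimple_image (fun A => diagonalizable A) g.

Definition nonsplit_semisimple g : Prop :=
  semisimple_image (fun A => irreducible_poly (char_poly A)) g.

Definition good_mod (t m : nat) : bool :=
  if odd t then (t %| m)%N else (4 * t %| m)%N.

Definition good_order (q : nat) g : Prop :=
  (split_semisimple g /\ good_mod #[g]%g (q - 1))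
  \/ (nonsplit_semisimple g /\ good_mod #[g]%g (q + 1)).

Definition bad_order (q : nat) g : Prop := semisimple g /\ ~ good_order q g.

Definition unipotent_class C : Prop :=
  exists2 u, unipotent u & C = (u ^: PSL2)%g.

End PSL2.

(* Main.v *)
(* Unipotent elements of SL_2 are the transvections [1 + a w w^T J], [w != 0],
   and the square class of [a] determines the conjugacy class, so that [C1] and
   [C2] correspond to [a] and [b] with [a b] a nonsquare.  Since
   [tr ((1 + a v v^T J) (1 + b w w^T J)) = 2 - a b (v^T J w)^2], and binary
   quadratic forms are universal, an [x] of trace [T != 2, -2] is such a product
   iff [(2 - T) / (a b)] is a square, i.e. iff [T - 2] has quadratic
   character [- chi (-1)].
   On the other hand [x] is split iff [chi (T^2 - 4) = 1], and evaluating
   [(2 x - T)^q] gives [x^q = x] or [x^q = x^-1] accordingly.  Evaluating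
   [(x + 1)^q] with [(x + 1)^2 = (T + 2) x] then gives
   [x^((q -+ 1) / 2) = chi (T + 2)], and the order is good iff this is [1]. *)
Require Import Defs.
From HB Require Import structures.
From mathcomp Require Import all_boot all_order all_algebra all_fingroup all_solvable all_field.
From mathcomp Require Import ring zify.

Set Implicit Arguments.
Unset Strict Implicit.
Unset Printing Implicit Defensive.

Import GRing.Theory.
Local Open Scope ring_scope.

(** * Two-by-two matrices *)

Section TwoByTwo.

Variable R : comNzRingType.
Implicit Types (a b c d : R) (A B : 'M[R]_2).

Definition mx2 a b c d : 'M[R]_2 :=
  \matrix_(i, j) if i == 0 then if j == 0 then a else b
                 else if j == 0 then c else d.

Lemma mx2E a b c d :
  [/\ mx2 a b c d 0 0 = a, mx2 a b c d 0 1 = b,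
      mx2 a b c d 1 0 = c & mx2 a b c d 1 1 = d].
Proof. by rewrite !mxE. Qed.

Lemma eq_mx2 A B :
    A 0 0 = B 0 0 -> A 0 1 = B 0 1 -> A 1 0 = B 1 0 -> A 1 1 = B 1 1 ->
  A = B.
Proof.
move=> e00 e01 e10 e11; apply/matrixP=> i j.
have ord2 (k : 'I_2) : k = 0 \/ k = 1.
  by case: k => [[|[|//]] ?]; [left | right]; apply/val_inj.
by case: (ord2 i) => ->; case: (ord2 j) => ->.
Qed.

Lemma mx2_eta A : A = mx2 (A 0 0) (A 0 1) (A 1 0) (A 1 1).
Proof. by apply: eq_mx2; rewrite mxE. Qed.

Lemma mx2_inj a b c d a' b' c' d' :
  mx2 a b c d = mx2 a' b' c' d' -> [/\ a = a', b = b', c = c' & d = d'].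
Proof.
move=> e; have [e1 e2 e3 e4] := mx2E a b c d.
have [f1 f2 f3 f4] := mx2E a' b' c' d'; rewrite e in e1 e2 e3 e4.
by split; [rewrite -e1 | rewrite -e2 | rewrite -e3 | rewrite -e4].
Qed.

Lemma mul_mx2 a b c d a' b' c' d' :
  mx2 a b c d * mx2 a' b' c' d' =
  mx2 (a * a' + b * c') (a * b' + b * d') (c * a' + d * c') (c * b' + d * d').
Proof.
by apply: eq_mx2; rewrite !mxE !big_ord_recl big_ord0 !mxE /= addr0.
Qed.

Lemma add_mx2 a b c d a' b' c' d' :
  mx2 a b c d + mx2 a' b' c' d' = mx2 (a + a') (b + b') (c + c') (d + d').
Proof. by apply: eq_mx2; rewrite !mxE. Qed.

Lemma opp_mx2 a b c d : - mx2 a b c d = mx2 (- a) (- b) (- c) (- d).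
Proof. by apply: eq_mx2; rewrite !mxE. Qed.

Lemma scale_mx2 k a b c d :
  k *: mx2 a b c d = mx2 (k * a) (k * b) (k * c) (k * d).
Proof. by apply: eq_mx2; rewrite !mxE. Qed.

Lemma scalar_mx2 k : k%:M = mx2 k 0 0 k.
Proof. by apply: eq_mx2; rewrite !mxE. Qed.

Lemma one_mx2 : 1 = mx2 1 0 0 1.
Proof. exact: scalar_mx2. Qed.

Lemma zero_mx2 : 0 = mx2 0 0 0 0.
Proof. by apply: eq_mx2; rewrite !mxE. Qed.

Lemma mxtrace_mx2 a b c d : \tr (mx2 a b c d) = a + d.
Proof. by rewrite /mxtrace !big_ord_recl big_ord0 !mxE /= addr0. Qed.

Lemma mxtrace2E A : \tr A = A 0 0 + A 1 1.
Proof. by rewrite {1}(mx2_eta A) mxtrace_mx2. Qed.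

Lemma det2E A : \det A = A 0 0 * A 1 1 - A 0 1 * A 1 0.
Proof.
rewrite (expand_det_row _ 0) !big_ord_recl big_ord0 /cofactor !det_mx11 !mxE /=.
rewrite addr0 expr0 expr1 mul1r mulN1r mulrN.
by congr (A _ _ * A _ _ - A _ _ * A _ _); apply/val_inj.
Qed.

Lemma det_mx2 a b c d : \det (mx2 a b c d) = a * d - b * c.
Proof. by rewrite det2E !mxE. Qed.

Definition mx2_simp := (mul_mx2, add_mx2, opp_mx2, scale_mx2, scalar_mx2,
  one_mx2, zero_mx2, mxtrace_mx2, det_mx2).

Lemma sqr_mx2 A : A * A = \tr A *: A - (\det A)%:M.
Proof. by rewrite (mx2_eta A) !mx2_simp; congr mx2; ring. Qed.

Lemma det_add1_mx2 A : \det (A + 1) = \det A + \tr A + 1.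
Proof. by rewrite (mx2_eta A) !mx2_simp; ring. Qed.

Lemma det_sub1_mx2 A : \det (A - 1) = \det A - \tr A + 1.
Proof. by rewrite (mx2_eta A) !mx2_simp; ring. Qed.

Lemma detX_mx2 A n : \det (A ^+ n) = \det A ^+ n.
Proof. by elim: n => [|n IHn]; rewrite ?det1 // !exprS det_mulmx IHn. Qed.

Definition disc A := \tr A ^+ 2 - 4%:R * \det A.

End TwoByTwo.

Lemma char_poly_mx2 (R : comNzRingType) (A : 'M[R]_2) :
  char_poly A = 'X^2 - (\tr A)%:P * 'X + (\det A)%:P.
Proof.
rewrite {1}/char_poly !det2E !mxE /= !mulr1n !mulr0n mxtrace2E.
by rewrite !(rmorphD, rmorphN, rmorphM) /=; ring.
Qed.

(** * The quadratic character *)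

Section QuadraticCharacter.

Variable F : finFieldType.
Hypothesis oddF : odd #|F|.
Implicit Types a b c x y : F.

(** Euler's formula for the quadratic character, with values in [F] itself, so that it can serve as
    a scalar in matrix identities. *)
Definition qchar a := a ^+ (#|F|.-1)./2.

Lemma card_gt1F : (1 < #|F|)%N.
Proof. exact: finNzRing_gt1. Qed.

Lemma card_pnat : ([pchar F].-nat #|F|)%N.
Proof.
have [p p_pr pcharF] := finPcharP F.
have : (p.-group [set: F])%g := abelem_pgroup (fin_ring_pchar_abelem pcharF).
by rewrite /pgroup cardsT (eq_pnat _ (pcharf_eq pcharF)).
Qed.

Lemma two_neq0 : 2%:R != 0 :> F.
Proof.
apply: contraL oddF => F2; have char2 : 2 \in [pchar F] by rewrite inE.
have [|_ dvd2 _] := pgroup_pdiv (abelem_pgroup (fin_ring_pchar_abelem char2)).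
  exact: finNzRing_nontrivial.
by rewrite -dvdn2 -cardsT.
Qed.

Lemma qcharM a b : qchar (a * b) = qchar a * qchar b.
Proof. exact: exprMn. Qed.

Lemma half_card_predK : ((#|F|.-1)./2 * 2 = #|F|.-1)%N.
Proof. by rewrite muln2; move: oddF; lia. Qed.

Lemma expf_card_pred x : x != 0 -> x ^+ #|F|.-1 = 1.
Proof.
move=> nzx; apply: (mulfI nzx); rewrite -exprS mulr1 prednK ?expf_card //.
exact: ltnW (card_gt1F).
Qed.

Lemma qchar_sqr x : x != 0 -> qchar (x ^+ 2) = 1.
Proof.
by move=> nzx; rewrite /qchar -exprM mulnC half_card_predK expf_card_pred.
Qed.

Lemma qchar_pm1 a : a != 0 -> qchar a = 1 \/ qchar a = -1.
Proof.
move=> nza; have: qchar a ^+ 2 == 1.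
  by rewrite -exprM half_card_predK expf_card_pred.
by rewrite sqrf_eq1 => /orP[]/eqP; [left | right].
Qed.

(** The unit group is cyclic. If [a] is the [k]-th power of a generator, then [#|F|.-1] divides
    [k * (#|F|.-1)./2], which makes [k] even. *)
Lemma qchar1_sqr a : qchar a = 1 -> exists2 s, s != 0 & a = s ^+ 2.
Proof.
move=> a1; have nza : a != 0.
  apply: contra_eq_neq a1 => ->; rewrite /qchar expr0n.
  have -> : ((#|F|.-1)./2 == 0)%N = false.
    by have := card_gt1F; move: oddF; lia.
  by rewrite eq_sym oner_eq0.
have /cyclicP[g defU] := field_unit_group_cyclic [set: {unit F}]%G.
have og : #[g]%g = #|F|.-1 by rewrite orderE -defU card_finField_unit.
have /cycleP[k ak] : finField_unit nza \in <[g]>%g by rewrite -defU inE.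
have aE : a = val g ^+ k by rewrite -FinRing.val_unitX -ak.
have : (#[g]%g %| k * (#|F|.-1)./2)%N.
  by rewrite order_dvdn -val_eqE FinRing.val_unitX /= exprM -aE -/(qchar a) a1.
rewrite og -{1}half_card_predK mulnC dvdn_pmul2r; last first.
  by have := card_gt1F; move: oddF; lia.
case/dvdnP=> j kj; exists (val g ^+ j); last by rewrite -exprM -kj.
by rewrite -unitfE rpredX // (valP g).
Qed.

Lemma neq_opp1 : 1 != -1 :> F.
Proof. by rewrite -subr_eq0 opprK two_neq0. Qed.

Lemma qchar_opp1_mod1 : #|F| = 1 %[mod 4] -> qchar (-1) = 1.
Proof.
move=> q1; rewrite /qchar -signr_odd; suff -> : odd (#|F|.-1)./2 = false by [].
by have := card_gt1F; lia.
Qed.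

Lemma qchar_opp1_mod3 : #|F| = 3 %[mod 4] -> qchar (-1) = -1.
Proof.
move=> q1; rewrite /qchar -signr_odd; suff -> : odd (#|F|.-1)./2 by [].
by have := card_gt1F; lia.
Qed.

(** The fibres of [f] have at most two elements; strictness comes from the parity of [#|F|]. *)
Lemma card_le_half_image (f : F -> F) :
    (forall x y, f x = f y -> x = y \/ x = - y) ->
  (#|F| < 2 * #|f @: setT|)%N.
Proof.
move=> f2; suff : (#|F| <= 2 * #|f @: setT|)%N by move: oddF; lia.
have -> : #|F| = (\sum_(x in [set: F]) 1)%N by rewrite sum1_card cardsT.
rewrite (partition_big_imset f) /= mulnC -sum_nat_const.
apply: leq_sum => v /imsetP[x _ ->]; rewrite sum1_card.
have /subset_leq_card /leq_trans-> // :
    [pred y in setT | f y == f x] \subset [set x; - x].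
  by apply/subsetP=> y; rewrite !inE /= => /eqP/f2[]->; rewrite eqxx ?orbT.
by rewrite cards2; case: (_ != _).
Qed.

(** Pigeonhole: the values of [a * x ^+ 2] and those of [c - b * y ^+ 2] each fill more than half of
    the field, so they meet. *)
Lemma binary_form_universal a b c :
  a != 0 -> b != 0 -> exists x y, a * x ^+ 2 + b * y ^+ 2 = c.
Proof.
move=> nza nzb.
have half (k l : F) : k != 0 ->
    (#|F| < 2 * #|[set (l + k * x ^+ 2)%R | x : F in [set: F]]|)%N.
  move=> nzk; apply: card_le_half_image => x y /addrI/(mulfI nzk)/eqP.
  by rewrite eqf_sqr => /orP[]/eqP; [left | right].
pose A := [set 0 + a * x ^+ 2 | x : F in [set: F]].
pose B := [set c + - b * y ^+ 2 | y : F in [set: F]].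
have ltA : (#|F| < 2 * #|A|)%N by apply: half.
have ltB : (#|F| < 2 * #|B|)%N by apply: half; rewrite oppr_eq0.
have : A :&: B != set0.
  apply: contraL (leq_add ltA ltB) => /eqP AB0; rewrite -ltnNge.
  have : (#|A :|: B| <= #|F|)%N by apply: max_card.
  rewrite cardsU AB0 cards0 subn0; lia.
case/set0Pn=> v /setIP[/imsetP[x _ ->] /imsetP[y _ e]].
by exists x, y; move: e; rewrite add0r => ->; ring.
Qed.

(* The point (x, 0) is moved off the axes along the rational parametrization
   of the conic; a parameter [m != 0] with [a + b * m ^+ 2 != 0] exists as soon
   as [m ^+ 2] takes two nonzero values, that is, for [#|F| > 3]. *)
Lemma binary_form_off_axis a b x :
    (3 < #|F|)%N -> a != 0 -> b != 0 -> qchar (a * b) = -1 -> x != 0 ->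
  exists x' y', [/\ x' != 0, y' != 0 &
    a * x' ^+ 2 + b * y' ^+ 2 = a * x ^+ 2].
Proof.
move=> F_gt3 nza nzb nsq nzx.
have [m nzm nzd] : exists2 m, m != 0 & a + b * m ^+ 2 != 0.
  have [ab0|] := eqVneq (a + b * 1 ^+ 2) 0; last first.
    by exists 1; rewrite ?oner_neq0.
  have /set0Pn[m] : ~: [set 0; 1; -1 : F] != set0.
    rewrite -card_gt0 cardsCs setCK subn_gt0 (leq_ltn_trans _ F_gt3) //.
    by rewrite cardsU cards2 cards1; case: (_ != _); lia.
  rewrite !inE !negb_or -andbA => /and3P[nzm m1 mN1]; exists m => //.
  rewrite -ab0 (inj_eq (addrI _)) (inj_eq (mulfI nzb)) eqf_sqr negb_or.
  by rewrite m1.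
exists (x * (a - b * m ^+ 2) / (a + b * m ^+ 2)).
exists (2%:R * a * m * x / (a + b * m ^+ 2)); split.
(* If [a - b * m ^+ 2] vanished, [a * b] would be the square of [b * m]. *)
- rewrite !mulf_neq0 ?invr_eq0 // subr_eq0; apply/eqP=> abm.
  have sq : a * b = (b * m) ^+ 2 by rewrite abm; ring.
  by move: nsq neq_opp1; rewrite sq qchar_sqr ?mulf_neq0 // => <-; rewrite eqxx.
- by rewrite !mulf_neq0 ?invr_eq0 ?two_neq0.
by field.
Qed.

(** The coordinates will scale the vectors of two transvections, which must stay nonzero. *)
Lemma binary_form_nonzero_coords a b c :
    (3 < #|F|)%N -> a != 0 -> b != 0 -> qchar (a * b) = -1 -> c != 0 ->
  exists x y, [/\ x != 0, y != 0 & a * x ^+ 2 + b * y ^+ 2 = c].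
Proof.
move=> F_gt3 nza nzb nsq nzc.
have [x [y]] := binary_form_universal c nza nzb.
have [-> | nzx] := eqVneq x 0; have [-> | nzy] := eqVneq y 0.
- by rewrite !expr0n /= !mulr0 addr0 => c0; rewrite -c0 eqxx in nzc.
- rewrite expr0n /= mulr0 add0r => <-; rewrite mulrC in nsq.
  have [y' [x' [nzy' nzx' e]]] := binary_form_off_axis F_gt3 nzb nza nsq nzy.
  by exists x', y'; rewrite addrC.
- rewrite expr0n /= mulr0 addr0 => <-; exact: binary_form_off_axis.
by move=> <-; exists x, y.
Qed.

End QuadraticCharacter.

(** * Powers of two-by-two matrices *)

Section Frobenius.

Variable F : finFieldType.
Hypothesis oddF : odd #|F|.
Implicit Types (A B : 'M[F]_2) (k : F).

Lemma card_half : #|F| = ((#|F|.-1)./2 * 2).+1.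
Proof. by rewrite half_card_predK // prednK // ltnW // card_gt1F. Qed.

(** Polynomials in one matrix commute, so additivity of the Frobenius map is transported from
    [{poly F}]. *)
Lemma horner_mx_expD_card A (p r : {poly F}) :
  horner_mx A (p + r) ^+ #|F| = horner_mx A p ^+ #|F| + horner_mx A r ^+ #|F|.
Proof.
rewrite -!rmorphXn -rmorphD exprDn_pchar //.
by rewrite (eq_pnat _ (pchar_poly F)) card_pnat.
Qed.

Lemma scalar_exp_card k : (k%:M : 'M[F]_2) ^+ #|F| = k%:M.
Proof. by rewrite -(rmorphXn (@scalar_mx F 2)) expf_card. Qed.

Lemma add1_exp_card A : (A + 1) ^+ #|F| = A ^+ #|F| + 1.
Proof.
have := horner_mx_expD_card A 'X 1.
by rewrite rmorphD /= horner_mx_X rmorph1 expr1n.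
Qed.

(** The matrix [B] below squares to the scalar [disc A], so its odd power [#|F|] is
    [qchar (disc A) *: B]; additivity computes the same power termwise. *)
Lemma frobenius_mx2 A :
  2%:R *: A ^+ #|F| - (\tr A)%:M =
  qchar (disc A) *: (2%:R *: A - (\tr A)%:M).
Proof.
set B := 2%:R *: A - (\tr A)%:M.
have BB : B * B = (disc A)%:M.
  rewrite /B /disc (mx2_eta A) !mx2_simp; congr mx2; ring.
have <- : B ^+ #|F| = 2%:R *: A ^+ #|F| - (\tr A)%:M.
  have := horner_mx_expD_card A (2%:R *: 'X) (- (\tr A))%:P.
  rewrite rmorphD /= linearZ /= horner_mx_X horner_mx_C raddfN /= => ->.
  rewrite -raddfN scalar_exp_card; congr (_ + _).
  rewrite -!mul_scalar_mx exprMn_comm ?scalar_exp_card //.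
  by apply/esym/scalar_mxC.
rewrite [in LHS]card_half exprS mulnC exprM expr2 BB.
rewrite -(rmorphXn (@scalar_mx F 2)).
by rewrite /= -scalemx1 -scalerAr mulr1.
Qed.

Lemma exp_card_split A : qchar (disc A) = 1 -> A ^+ #|F| = A.
Proof.
move=> d1; have := frobenius_mx2 A; rewrite d1 scale1r => /addIr.
exact/scalerI/two_neq0.
Qed.

(** Here [A ^+ #|F|] is the adjugate [(\tr A)%:M - A], and Cayley-Hamilton concludes. *)
Lemma exp_card_nonsplit A : qchar (disc A) = -1 ->
  A * A ^+ #|F| = (\det A)%:M.
Proof.
move=> d1; have := frobenius_mx2 A; rewrite d1 scaleN1r opprB.
move/(canRL (subrK _)); set B := A ^+ _ => e.
have -> : B = (\tr A)%:M - A.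
  apply: (scalerI (two_neq0 oddF)); rewrite e scalerBr !scaler_nat !mulr2n.
  by rewrite addrAC.
rewrite mulrBr sqr_mx2 opprB -mulmxE scalar_mxC mul_scalar_mx.
by rewrite addrCA subrr addr0.
Qed.

Lemma scalar_of_fixed B C k : B \in unitmx -> k * k = 1 ->
  B = k *: (B * C) -> C = k%:M.
Proof.
move=> uB kk e; apply: (mulrI uB).
by rewrite -mulmxE scalar_mxC mul_scalar_mx mulmxE {2}e scalerA kk scale1r.
Qed.

Lemma add1_exp_card_sl A : \det A = 1 ->
  (A + 1) ^+ #|F| =
  qchar (\tr A + 2%:R) *: ((A + 1) * A ^+ (#|F|.-1)./2).
Proof.
move=> dA; rewrite [in LHS]card_half exprS mulnC exprM.
have -> : (A + 1) ^+ 2 = (\tr A + 2%:R) *: A.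
  rewrite expr2 mulrDl !mulrDr sqr_mx2 dA !mul1r mulr1 (mx2_eta A) !mx2_simp.
  by congr mx2; ring.
by rewrite exprZn scalerAr.
Qed.

(** The factor [A + 1] cancels because its determinant is [\tr A + 2%:R]; the character, being 1 or
    -1, is its own inverse. *)
Lemma half_powerP A B :
    \det A = 1 -> \tr A + 2%:R != 0 ->
    A + 1 = qchar (\tr A + 2%:R) *: ((A + 1) * B) ->
  B = (qchar (\tr A + 2%:R))%:M.
Proof.
move=> dA T2; apply: scalar_of_fixed.
  by rewrite unitmxE unitfE det_add1_mx2 dA addrAC addrC addrA -addrA.
by case: (qchar_pm1 oddF T2) => ->; rewrite ?mulrNN mulr1.
Qed.

Lemma half_power_split A :
    \det A = 1 -> \tr A + 2%:R != 0 -> qchar (disc A) = 1 ->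
  A ^+ (#|F|.-1)./2 = (qchar (\tr A + 2%:R))%:M.
Proof.
move=> dA T2 d1; apply: half_powerP => //.
by rewrite -add1_exp_card_sl // add1_exp_card exp_card_split.
Qed.

Lemma half_power_nonsplit A :
    \det A = 1 -> \tr A + 2%:R != 0 -> qchar (disc A) = -1 ->
  A ^+ (#|F|.+1)./2 = (qchar (\tr A + 2%:R))%:M.
Proof.
move=> dA T2 d1; apply: half_powerP => //.
(* Multiplication by [A] turns [A ^+ #|F| + 1] back into [A + 1], at the cost of one more factor [A]
   in the half power. *)
have -> : (#|F|.+1)./2 = (#|F|.-1)./2.+1 by move: oddF; lia.
rewrite exprSr mulrA scalerAl -add1_exp_card_sl // add1_exp_card mulrDl mul1r.
by rewrite -exprSr exprS exp_card_nonsplit // dA addrC.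
Qed.

End Frobenius.

(** * The quotient of SL_2 by its center *)

Section SpecialLinear.

Variable F : finFieldType.
Hypothesis oddF : odd #|F|.
Implicit Types (A : 'M[F]_2) (x y : {'GL_2[F]}).

Lemma SL2_lift A : \det A = 1 -> exists2 x, x \in SL2 F & GLval x = A.
Proof.
move=> dA; have uA : A \is a GRing.unit by rewrite unitmxE dA unitr1.
by exists (Sub A uA : {'GL_2[F]}); rewrite ?inE SubK ?dA.
Qed.

Lemma det_SL2 x : x \in SL2 F -> \det (GLval x) = 1.
Proof. by rewrite inE => /eqP. Qed.

Lemma GLval_inj : injective (@GLval 2 F).
Proof. exact: val_inj. Qed.

Lemma GLvalX x n : GLval (x ^+ n)%g = GLval x ^+ n.
Proof. exact: FinRing.val_unitX. Qed.

Lemma GLval_pmI z : z \in pmI F -> GLval z = 1 \/ GLval z = -1.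
Proof. by rewrite !inE => /orP[]/eqP; [left | right]. Qed.

Lemma pmI_central : pmI F \subset 'C([set: {'GL_2[F]}])%g.
Proof.
apply/centsP=> z /GLval_pmI zE x _; apply: GLval_inj; rewrite !GL_ME.
by case: zE => ->; rewrite ?mulN1r ?mulrN1 ?mul1r ?mulr1.
Qed.

Lemma norm_pmI x : x \in 'N(pmI F)%g.
Proof.
by apply: (subsetP (cents_norm _)) (in_setT x); rewrite centsC pmI_central.
Qed.

Lemma coset_pmI_eqP x y :
  coset (pmI F) x = coset (pmI F) y ->
  GLval x = GLval y \/ GLval x = - GLval y.
Proof.
move/(rcoset_kercosetP (norm_pmI x) (norm_pmI y))/rcosetP=> [z zI ->].
by rewrite GL_ME; case: (GLval_pmI zI) => ->; rewrite ?mul1r ?mulN1r; auto.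
Qed.

Lemma coset_pmI_opp x y :
  GLval x = - GLval y -> coset (pmI F) x = coset (pmI F) y.
Proof.
move=> xy; have [|z zSL zE] := @SL2_lift (-1).
  by rewrite det2E !mxE /=; ring.
have -> : x = (z * y)%g by apply: GLval_inj; rewrite GL_ME zE mulN1r.
by apply: coset_kerl; rewrite !inE zE eqxx orbT.
Qed.

Lemma coset_pmI_eq1 x :
  (coset (pmI F) x == 1%g) = (GLval x == 1) || (GLval x == -1).
Proof.
apply/eqP/idP => [/(coset_idr (norm_pmI x)) | xI]; first by rewrite !inE.
by apply: coset_id; rewrite !inE.
Qed.

Lemma SL2_opp x : x \in SL2 F ->
  exists2 y, y \in SL2 F & GLval y = - GLval x.
Proof.
move/det_SL2=> dx; apply: SL2_lift; rewrite -dx !det2E !mxE; ring.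
Qed.

(** By Cayley-Hamilton, [\tr A *: A] is the scalar 2, which is nonzero; hence [A] is scalar. *)
Lemma SL2_sqr1 A : \det A = 1 -> A * A = 1 -> A = 1 \/ A = -1.
Proof.
move=> dA AA; have := sqr_mx2 A; rewrite AA dA => /esym/eqP.
rewrite subr_eq => /eqP TA.
have nzT : \tr A != 0.
  apply: contraTneq (two_neq0 oddF) => T0; rewrite T0 scale0r in TA.
  move/matrixP/(_ 0 0): TA; rewrite !mxE /= !mulr1n => /esym/eqP.
  by rewrite negbK.
have [k kE] : exists k, A = k%:M.
  exists (2%:R / \tr A); apply: (scalerI nzT); rewrite TA -[1]/1%:M.
  by rewrite scale_scalar_mx mulrC divfK // -raddfD.
move: AA; rewrite kE -mulmxE -scalar_mxM -[1]/1%:M => /matrixP/(_ 0 0).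
rewrite !mxE /= !mulr1n -expr2 => /eqP; rewrite sqrf_eq1.
by case/orP=> /eqP->; [left | right; rewrite raddfN].
Qed.

(** Let [t] be the order of the image, so that [A ^+ t] is 1 or -1. For odd [t] both sides hold,
    [m./2] being an even multiple of [t]. For even [t] one has [A ^+ t = -1], and [A ^+ m./2 = 1]
    says again that [m./2] is an even multiple of [t], that is, [4 * t %| m]. *)
Lemma good_modP x m : x \in SL2 F -> (4 %| m)%N -> (0 < m)%N ->
    GLval x ^+ m = 1 ->
  good_mod #[coset (pmI F) x]%g m <-> GLval x ^+ m./2 = 1.
Proof.
move=> xSL m4 m_gt0 xm; set g := coset _ x; set A := GLval x in xm *.
have gX n : (#[g]%g %| n)%N = (A ^+ n == 1) || (A ^+ n == -1).
  by rewrite order_dvdn -morphX ?norm_pmI // coset_pmI_eq1 GLvalX.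
have N1 : (-1 : 'M[F]_2) <> 1.
  move/matrixP/(_ 0 0); rewrite !mxE /= => /esym/eqP.
  by rewrite mulr1n (negPf (neq_opp1 oddF)).
have t_gt0 := order_gt0 g; set t := #[g]%g in gX t_gt0 *.
have tm : (t %| m)%N by rewrite gX xm eqxx.
have m2 : m = (m./2 * 2)%N by lia.
rewrite /good_mod; case: ifP => [t_odd | t_even].
  split=> // _; have /dvdnP[j jE] : (t %| m %/ 4)%N.
    rewrite -(Gauss_dvdr _ (n := 4)) 1?mulnC ?divnK //.
    by rewrite -[4%N]/(2 ^ 2)%N coprimeXr // coprimen2.
  have -> : m./2 = (t * (j * 2))%N by lia.
  have /orP[] : (A ^+ t == 1) || (A ^+ t == -1) by rewrite -gX.
    by rewrite exprM => /eqP->; rewrite expr1n.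
  by rewrite exprM => /eqP->; rewrite mulnC exprM sqrrN !expr1n.
(* Otherwise [A ^+ t./2] would square to 1, hence be 1 or -1, and [t] would divide [t./2]. *)
have tN : A ^+ t = -1.
  have /orP[/eqP t1 | /eqP //] : (A ^+ t == 1) || (A ^+ t == -1) by rewrite -gX.
  have dA : \det (A ^+ t./2) = 1.
    by rewrite -GLvalX det_SL2 ?groupX.
  have AA : A ^+ t./2 * A ^+ t./2 = 1.
    by rewrite -exprD addnn -t1; congr (_ ^+ _); lia.
  have : (t %| t./2)%N.
    by rewrite gX; case: (SL2_sqr1 dA AA) => ->; rewrite eqxx ?orbT.
  by move/dvdn_leq; lia.
split=> [/dvdnP[j jE] | m1].
  have -> : m./2 = (t * (2 * j))%N by lia.
  by rewrite exprM tN exprM sqrrN !expr1n.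
have /dvdnP[j jE] : (t %| m./2)%N by rewrite gX m1 eqxx.
move: m1; rewrite jE mulnC exprM tN -signr_odd.
case: (boolP (odd j)) => [_ | j_even _]; first by rewrite expr1 => /N1.
have j2 : j = (j./2 * 2)%N by lia.
by rewrite m2 jE j2 -!mulnA; apply/dvdnP; exists j./2; lia.
Qed.

End SpecialLinear.

(** * Semisimple elements *)

Section Semisimple.

(** The eigenvalues [(\tr A + s) / 2] and [(\tr A - s) / 2] are distinct, so the minimal polynomial
    divides a product of distinct linear factors. *)
Lemma diagonalizable_disc (K : fieldType) (A : 'M[K]_2) (s : K) :
    2%:R != 0 :> K -> s != 0 -> disc A = s ^+ 2 ->
  diagonalizable A.
Proof.
move=> K2 nzs dA; apply/diagonalizableP.
pose r1 := (\tr A + s) / 2%:R; pose r2 := (\tr A - s) / 2%:R.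
have sr : r1 + r2 = \tr A by rewrite /r1 /r2; field.
have pr : r1 * r2 = \det A.
  have : 4%:R * \det A = \tr A ^+ 2 - s ^+ 2 by rewrite -dA /disc; ring.
  move=> dE; have K4 : 4%:R != 0 :> K by rewrite (natrM _ 2 2) mulf_neq0.
  by apply: (mulfI K4); rewrite dE /r1 /r2; field.
exists [:: r1; r2].
  rewrite /= inE andbT; apply: contraNneq nzs => r12.
  have -> : s = r1 - r2 by rewrite /r1 /r2; field.
  by rewrite r12 subrr.
rewrite !big_cons big_nil mulr1 (dvdp_trans (mxminpoly_dvd_char A)) //.
have -> // : char_poly A = ('X - r1%:P) * ('X - r2%:P).
by rewrite char_poly_mx2 -sr -pr !(rmorphD, rmorphM) /=; ring.
Qed.

Lemma disc_root (K : fieldType) (A : 'M[K]_2) (z : K) :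
  root (char_poly A) z -> disc A = (2%:R * z - \tr A) ^+ 2.
Proof.
rewrite rootE char_poly_mx2 !hornerE /disc => /eqP e.
rewrite -[RHS]addr0 -(mulr0 (- 4%:R)) -e; ring.
Qed.

Lemma disc_root_exists (K : fieldType) (A : 'M[K]_2) (s : K) :
  2%:R != 0 :> K -> disc A = s ^+ 2 -> root (char_poly A) ((\tr A + s) / 2%:R).
Proof.
move=> K2 dA; have K4 : 4%:R != 0 :> K by rewrite (natrM _ 2 2) mulf_neq0.
have dE : 4%:R * \det A = \tr A ^+ 2 - s ^+ 2 by rewrite -dA /disc; ring.
rewrite rootE char_poly_mx2 !hornerE /=; apply/eqP; apply: (mulfI K4).
by rewrite mulr0 mulrDr dE; field.
Qed.

Lemma disc_opp (R : comNzRingType) (A : 'M[R]_2) : disc (- A) = disc A.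
Proof. by rewrite /disc !det2E !mxtrace2E !mxE; ring. Qed.

Lemma disc_map (K L : fieldType) (f : {rmorphism K -> L}) (A : 'M[K]_2) :
  disc (map_mx f A) = f (disc A).
Proof.
by rewrite /disc det_map_mx trace_map_mx rmorphB rmorphXn rmorphM rmorph_nat.
Qed.

(** The square root [s] is the difference of the two eigenvalues in a diagonal form. *)
Lemma disc_diagonalizable (K : fieldType) (A : 'M[K]_2) :
    diagonalizable A ->
  exists2 s, disc A = s ^+ 2 & s = 0 -> exists k, A = k%:M.
Proof.
case=> P uP /similar_diagPex[d /(similarLR uP)]; rewrite conjVmx // => AE.
exists (d 0 0 - d 0 1).
  have trA : \tr A = d 0 0 + d 0 1.
    by rewrite AE mxtrace_mulC mulmxA mulmxV // mul1mx mxtrace2E !mxE.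
  have detA : \det A = d 0 0 * d 0 1.
    rewrite AE !det_mulmx det_inv mulrAC mulVf ?mul1r -?unitfE -?unitmxE //.
    by rewrite det2E !mxE /= !mulr1n !mulr0n mulr0 subr0.
  by rewrite /disc trA detA; ring.
move/subr0_eq=> d01; exists (d 0 0).
have -> : A = invmx P *m (d 0 0)%:M *m P.
  rewrite AE; congr (_ *m _ *m _); apply: eq_mx2; rewrite !mxE //= -?d01 //.
by rewrite scalar_mxC -mulmxA mulVmx // mulmx1.
Qed.

Variable F : finFieldType.
Hypothesis oddF : odd #|F|.
Implicit Types (A : 'M[F]_2) (x y : {'GL_2[F]}).

Let F2 := two_neq0 oddF.

Lemma qchar0 : qchar (0 : F) = 0.
Proof.
rewrite /qchar expr0n; have -> // : ((#|F|.-1)./2 == 0)%N = false.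
by have := card_gt1F F; move: oddF; lia.
Qed.

Lemma qcharN1_neq_sqr (s : F) : qchar (s ^+ 2) <> -1.
Proof.
have [-> | nzs] := eqVneq s 0.
  by rewrite expr0n qchar0 => /eqP; rewrite eq_sym oppr_eq0 oner_eq0.
by rewrite qchar_sqr // => /eqP; rewrite (negPf (neq_opp1 oddF)).
Qed.

(** A quadratic polynomial is irreducible iff it has no root, and in odd characteristic it has a
    root iff its discriminant is a square, 0 included. *)
Lemma irreducible_char_polyP A :
  irreducible_poly (char_poly A) <-> qchar (disc A) = -1.
Proof.
split=> [[_ irrA] | dA].
  have nosqr s : disc A <> s ^+ 2.
    move/(disc_root_exists F2); rewrite -dvdp_XsubCl => /irrA.
    rewrite size_XsubC => /(_ isT)/eqp_size.
    by rewrite size_XsubC size_char_poly.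
  have nzd : disc A != 0 by apply/eqP=> d0; apply: (nosqr 0); rewrite expr0n.
  by case: (qchar_pm1 oddF nzd) => // /(qchar1_sqr oddF)[s _ /nosqr].
apply: cubic_irreducible => [|z]; first by rewrite size_char_poly.
apply/negP=> /disc_root dz.
by apply: (@qcharN1_neq_sqr (2%:R * z - \tr A)); rewrite -dz.
Qed.

Lemma disc_center x : x \in 'Z(SL2 F)%g -> disc (GLval x) = 0.
Proof.
case/centerP=> _ cx.
(* Commuting with this one matrix already forces a zero upper right entry and equal diagonal
   entries. *)
have [|v vSL vE] := @SL2_lift F (mx2 1 0 1 1); first by rewrite !mx2_simp; ring.
have := congr1 (@GLval 2 F) (cx v vSL); rewrite !GL_ME vE /disc.
move: (GLval x) => A; rewrite (mx2_eta A) !mx2_simp => /mx2_inj[].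
rewrite !(mulr1, mul1r, mul0r, mulr0, addr0) => /eqP.
rewrite -subr_eq0 addrC addKr => /eqP-> _.
by rewrite addrC => /addIr-> _; ring.
Qed.

Lemma scalar_center x k : x \in SL2 F -> GLval x = k%:M -> x \in 'Z(SL2 F)%g.
Proof.
move=> xSL xE; apply/centerP; split=> // y _; apply: GLval_inj.
by rewrite !GL_ME xE -!mulmxE scalar_mxC.
Qed.

(** The extension is [F] itself when the discriminant is a square; otherwise a root of the
    characteristic polynomial is adjoined. *)
Lemma semisimple_disc A : disc A != 0 -> semisimple_mx A.
Proof.
move=> nzd.
have diagL (L : fieldExtType F) (s : L) :
    s ^+ 2 = disc (map_mx (in_alg L) A) -> semisimple_mx A.
  move=> sE; exists L; apply: (@diagonalizable_disc _ _ s); rewrite -?sE //.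
    by rewrite -(rmorph_nat (in_alg L)) fmorph_eq0.
  by rewrite -sqrf_eq0 sE disc_map fmorph_eq0.
case: (qchar_pm1 oddF nzd) => [/(qchar1_sqr oddF)[s _ dA] | dA].
  by apply: (diagL F^o (in_alg F^o s)); rewrite disc_map dA rmorphXn.
have [L _ [z rz _]] := irredp_FAdjoin ((irreducible_char_polyP A).2 dA).
apply: (diagL L (2%:R * z - \tr (map_mx (in_alg L) A))).
by rewrite -disc_root // -map_char_poly.
Qed.

(** A preimage in [SL2 F] is determined up to sign, which [disc] does not see. *)
Lemma split_semisimpleP x : x \in SL2 F ->
  split_semisimple (coset (pmI F) x) <-> qchar (disc (GLval x)) = 1.
Proof.
move=> xSL; split=> [[y [ySL yZ _ /disc_diagonalizable[s sE s0] xy]] | dx].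
  have -> : disc (GLval x) = s ^+ 2.
    by case: (coset_pmI_eqP xy) => ->; rewrite ?disc_opp.
  apply/qchar_sqr=> //; apply: contraNneq yZ => /s0[k]; exact: scalar_center.
have [s nzs sE] := qchar1_sqr oddF dx; exists x; split=> //.
- by apply/negP=> /disc_center d0; move: nzs; rewrite -sqrf_eq0 -sE d0 eqxx.
- by apply: semisimple_disc; rewrite sE expf_neq0.
exact: diagonalizable_disc sE.
Qed.

Lemma nonsplit_semisimpleP x : x \in SL2 F ->
  nonsplit_semisimple (coset (pmI F) x) <-> qchar (disc (GLval x)) = -1.
Proof.
move=> xSL; split=> [[y [ySL yZ _ /irreducible_char_polyP dy xy]] | dx].
  by case: (coset_pmI_eqP xy) => ->; rewrite ?disc_opp.
have nzd : disc (GLval x) != 0.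
  apply/eqP=> d0; move/eqP: dx.
  by rewrite d0 qchar0 eq_sym oppr_eq0 oner_eq0.
exists x; split=> //; last exact/irreducible_char_polyP.
  by apply/negP=> /disc_center/eqP; apply/negP.
exact: semisimple_disc.
Qed.

Lemma semisimple_coset x : x \in SL2 F -> disc (GLval x) != 0 ->
  semisimple (coset (pmI F) x).
Proof.
move=> xSL nzd; exists x; split=> //; last exact: semisimple_disc.
by apply/negP=> /disc_center/eqP; apply/negP.
Qed.

End Semisimple.

(** * Unipotent elements *)

Section Transvections.

Variable F : finFieldType.
Hypothesis oddF : odd #|F|.
Implicit Types (A B : 'M[F]_2) (x y z e h : {'GL_2[F]}) (a b c p r s k : F).
Implicit Types (g : coset_of (pmI F)) (C : {set coset_of (pmI F)}).

Let F2 := two_neq0 oddF.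

(* [1 + a w w^T J] with [w = (p, r)^T] and [J = [[0, 1], [-1, 0]]]. *)
Definition transv a p r : 'M[F]_2 :=
  mx2 (1 - a * p * r) (a * p ^+ 2) (- a * r ^+ 2) (1 + a * p * r).

Lemma det_transv a p r : \det (transv a p r) = 1.
Proof. by rewrite mx2_simp; ring. Qed.

Lemma tr_transv a p r : \tr (transv a p r) = 2%:R.
Proof. by rewrite mx2_simp; ring. Qed.

Lemma transv0 p r : transv 0 p r = 1.
Proof. by rewrite /transv !mx2_simp; congr mx2; ring. Qed.

Lemma transv_scale a s p r : transv (a * s ^+ 2) p r = transv a (s * p) (s * r).
Proof. by rewrite /transv; congr mx2; ring. Qed.

Lemma transvM a b p r : transv a p r * transv b p r = transv (a + b) p r.
Proof. by rewrite /transv mx2_simp; congr mx2; ring. Qed.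

Lemma transvK a p r A : transv a p r * (transv (- a) p r * A) = A.
Proof. by rewrite mulrA transvM subrr transv0 mul1r. Qed.

Lemma tr_mul_transv a p r b p' r' :
  \tr (transv a p r * transv b p' r') = 2%:R - a * b * (p * r' - r * p') ^+ 2.
Proof. by rewrite /transv !mx2_simp; ring. Qed.

(** The factor of [a] is the quadratic form [w^T J A w], whose discriminant is [disc A]. *)
Lemma tr_transv_mul a p r A :
  \tr (transv a p r * A) = \tr A +
    a * (A 1 0 * p ^+ 2 + (A 1 1 - A 0 0) * p * r - A 0 1 * r ^+ 2).
Proof.
by rewrite /transv {1}(mx2_eta A) !mx2_simp mxtrace2E; ring.
Qed.

(** Conjugation of a transvection moves its vector; the identity rests on
    [A^T J A = \det A *: J]. *)
Lemma transv_act a A p r :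
  transv a (A 0 0 * p + A 0 1 * r) (A 1 0 * p + A 1 1 * r) * A =
  A + \det A *: (A * (transv a p r - 1)).
Proof.
have [u [v [w [t ->]]]] : exists u v w t, A = mx2 u v w t.
  by exists (A 0 0), (A 0 1), (A 1 0), (A 1 1); apply: mx2_eta.
by rewrite !mxE /= /transv !mx2_simp; congr mx2; ring.
Qed.

Lemma transv_conj x y z a p r p' r' :
    x \in SL2 F -> GLval y = transv a p r -> GLval z = transv a p' r' ->
    GLval x 0 0 * p' + GLval x 0 1 * r' = p ->
    GLval x 1 0 * p' + GLval x 1 1 * r' = r ->
  z = (y ^ x)%g.
Proof.
move=> /det_SL2 dx yE zE pE rE; apply: (mulgI x); rewrite -conjgC.
apply: GLval_inj; rewrite !GL_ME yE zE -pE -rE transv_act dx scale1r.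
by rewrite mulrBr mulr1 addrC subrK.
Qed.

(** The relation [bc] expresses that [A - 1] is singular. The parameter and the vector are read off
    the first row, or off the lower left entry when [A 0 1] vanishes. *)
Lemma transv_of_trace A : \det A = 1 -> \tr A = 2%:R -> A != 1 ->
  exists a p r, [/\ a != 0, (p != 0) || (r != 0) & A = transv a p r].
Proof.
move=> dA tA A1.
have dE : A 1 1 = 2%:R - A 0 0 by rewrite -tA mxtrace2E; ring.
have bc : A 0 1 * A 1 0 = - (A 0 0 - 1) ^+ 2.
  move: dA; rewrite det2E dE => dA.
  have -> : A 0 1 * A 1 0 = A 0 0 * (2%:R - A 0 0) - 1.
    by rewrite -[X in _ - X]dA; ring.
  by ring.
have [b0 | nzb] := eqVneq (A 0 1) 0.
  have a1 : A 0 0 = 1.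
    by move/esym/eqP: bc; rewrite b0 mul0r oppr_eq0 sqrf_eq0 subr_eq0 => /eqP.
  exists (- A 1 0), 0, 1; split; rewrite ?oner_neq0 ?orbT //.
    apply: contra A1; rewrite oppr_eq0 => /eqP c0.
    by rewrite (mx2_eta A) b0 c0 dE a1 one_mx2; apply/eqP; congr mx2; ring.
  by rewrite {1}(mx2_eta A) /transv b0 dE a1; congr mx2; ring.
exists (A 0 1), 1, ((1 - A 0 0) / A 0 1); rewrite oner_neq0; split=> //.
have cE : A 1 0 = - (A 0 0 - 1) ^+ 2 / A 0 1 by rewrite -bc mulrAC mulfV ?mul1r.
by rewrite {1}(mx2_eta A) /transv dE cE; congr mx2; field.
Qed.

(** A nilpotent [A - 1] has determinant 0, and this determinant is [2%:R - \tr A]; conversely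
    Cayley-Hamilton gives [(A - 1) ^+ 2 = 0]. *)
Lemma unipotent_mxP A : \det A = 1 -> unipotent_mx A <-> \tr A = 2%:R.
Proof.
move=> dA; split=> [[n An] | tA].
  have : \det (A - 1) ^+ n = 0.
    by rewrite -detX_mx2 An det0.
  move/eqP; rewrite expf_eq0 det_sub1_mx2 dA addrAC subr_eq0.
  by case/andP=> _ /eqP/esym.
exists 2%N; rewrite expr2 mulrBl mul1r mulrBr mulr1 sqr_mx2 dA tA.
by rewrite (mx2_eta A) !mx2_simp; congr mx2; ring.
Qed.

Lemma unipotentP g : unipotent g <->
  exists x, [/\ x \in SL2 F, GLval x != 1, \tr (GLval x) = 2%:R
              & g = coset (pmI F) x].
Proof.
split=> -[x [xSL x1 xu ->]]; exists x; split=> //.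
- exact/(unipotent_mxP (det_SL2 xSL)).
- exact/(unipotent_mxP (det_SL2 xSL)).
Qed.

(** [SL2 F] is transitive on nonzero vectors: [(p, r)] is completed to the first column of a matrix
    of determinant 1. *)
Lemma transv_conj_std x e a p r :
    (p != 0) || (r != 0) -> GLval x = transv a p r -> GLval e = transv a 1 0 ->
  exists2 h, h \in SL2 F & x = (e ^ h)%g.
Proof.
move=> nz xE eE.
have [b [d bd]] : exists b d, p * d - b * r = 1.
  have [p0 | nzp] := eqVneq p 0; last first.
    by exists 0, p^-1; rewrite mul0r subr0 mulfV.
  exists (- r^-1), 0; rewrite mulr0 sub0r mulNr opprK mulVf //.
  by move: nz; rewrite p0 eqxx.
have [|h hSL hE] := @SL2_lift F (mx2 p b r d); first by rewrite mx2_simp.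
exists h^-1%g; first by rewrite groupV.
apply: (canRL (conjgK h)); symmetry.
by apply: (transv_conj hSL xE eE); rewrite hE !mxE /=; ring.
Qed.

Lemma unipotent_class_std C : unipotent_class C ->
  exists a e, [/\ a != 0, e \in SL2 F, GLval e = transv a 1 0 &
    C = (coset (pmI F) e ^: PSL2 F)%g].
Proof.
case=> u /unipotentP[x [xSL x1 xu ->]] ->.
have [a [p [r [nza nz xE]]]] := transv_of_trace (det_SL2 xSL) xu x1.
have [e eSL eE] := SL2_lift (det_transv a 1 0).
have [h hSL ->] := transv_conj_std nz xE eE.
exists a, e; split=> //; rewrite morphJ ?norm_pmI // classGidl //.
exact: mem_quotient.
Qed.

Lemma mem_class_std a e g : e \in SL2 F -> GLval e = transv a 1 0 ->
  g \in (coset (pmI F) e ^: PSL2 F)%g <->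
  exists x p r, [/\ x \in SL2 F, (p != 0) || (r != 0),
    GLval x = transv a p r & g = coset (pmI F) x].
Proof.
move=> eSL eE; split=> [/imsetP[k /morphimP[h _ hSL ->] ->] | ].
  rewrite -morphJ ?norm_pmI //.
  have dh := det_SL2 hSL; rewrite det2E in dh.
  (* This vector is the first column of the inverse of [h], that is, the image of [(1, 0)] under
     it. *)
  have [z zSL zE] := SL2_lift (det_transv a (GLval h 1 1) (- GLval h 1 0)).
  exists (e ^ h)%g, (GLval h 1 1), (- GLval h 1 0); split=> //.
  - by rewrite groupJ.
  - rewrite oppr_eq0 -negb_and; apply/negP=> /andP[/eqP d0 /eqP c0].
    by move/eqP: dh; rewrite d0 c0 !mulr0 subr0 eq_sym oner_eq0.
  rewrite -zE; congr GLval; symmetry; apply: (transv_conj hSL eE zE).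
    by rewrite -dh; ring.
  by ring.
case=> x [p [r [xSL nz xE ->]]].
have [h hSL ->] := transv_conj_std nz xE eE.
by rewrite morphJ ?norm_pmI // memJ_class // mem_quotient.
Qed.

(** Completing the square turns a nonzero multiple of the form into [X ^+ 2 - disc A * Y ^+ 2],
    which is universal. If the first coefficient is 0, the square is completed in the other
    variable; if both square terms vanish, the form is a multiple of [p * r]. *)
Lemma form_represents A c : disc A != 0 ->
  exists p r, A 1 0 * p ^+ 2 + (A 1 1 - A 0 0) * p * r - A 0 1 * r ^+ 2 = c.
Proof.
have -> : disc A = (A 1 1 - A 0 0) ^+ 2 + 4%:R * A 1 0 * A 0 1.
  by rewrite /disc det2E mxtrace2E; ring.
move: (A 1 0) (A 0 1) (A 1 1 - A 0 0) => u v w nzd.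
have F4 : 4%:R != 0 :> F by rewrite (natrM _ 2 2) mulf_neq0.
have nzNd : - (w ^+ 2 + 4%:R * u * v) != 0 by rewrite oppr_eq0.
have [u0 | nzu] := eqVneq u 0.
  have [v0 | nzv] := eqVneq v 0.
    have nzw : w != 0.
      by apply: contraNneq nzd => ->; rewrite u0 v0 !mulr0 expr0n addr0.
    by exists 1, (c / w); rewrite u0 v0; field.
  have [X [Y XY]] :=
    binary_form_universal oddF (- 4%:R * v * c) (oner_neq0 _) nzNd.
  exists Y, ((w * Y - X) / (2%:R * v)).
  have -> : c = (- 4%:R * v * c) / (- 4%:R * v).
    by field; rewrite oppr_eq0 F4 nzv.
  by rewrite -XY u0; field; rewrite oppr_eq0 F4 nzv F2.
have [X [Y XY]] :=
  binary_form_universal oddF (4%:R * u * c) (oner_neq0 _) nzNd.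
exists ((X - w * Y) / (2%:R * u)), Y.
have -> : c = (4%:R * u * c) / (4%:R * u) by field; rewrite F4 nzu.
by rewrite -XY; field; rewrite F4 nzu F2.
Qed.

(* [transv (- a) p r * A] has trace 2 for [(p, r)] representing [- b * s ^+ 2]
   by the quadratic form of [A], and the type of this unipotent matrix is then
   read off the trace. *)
Lemma transv_product A a b s :
    a != 0 -> b != 0 -> s != 0 -> \det A = 1 ->
    \tr A = 2%:R - a * b * s ^+ 2 -> disc A != 0 ->
  exists p r p' r', [/\ (p != 0) || (r != 0), (p' != 0) || (r' != 0) &
    A = transv a p r * transv b p' r'].
Proof.
move=> nza nzb nzs dA tA nzd.
have [p [r pr]] := form_represents (- (b * s ^+ 2)) nzd.
have nzpr : (p != 0) || (r != 0).
  rewrite -negb_and; apply: contraTN (mulf_neq0 nzb (expf_neq0 2 nzs)).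
  case/andP=> /eqP p0 /eqP r0; rewrite negbK -oppr_eq0 -pr p0 r0.
  by apply/eqP; ring.
set B := transv (- a) p r * A.
have AE : A = transv a p r * B by rewrite transvK.
have dB : \det B = 1 by rewrite det_mulmx det_transv dA mulr1.
have tB : \tr B = 2%:R by rewrite tr_transv_mul pr tA; ring.
have nzs2 : a * b * s ^+ 2 != 0 by rewrite !mulf_neq0.
have B1 : B != 1.
  apply: contraNneq nzs2 => B1; move: tA; rewrite {1}AE B1 mulr1 tr_transv.
  by move/esym/eqP; rewrite -subr_eq0 addrAC subrr sub0r oppr_eq0.
have [b' [p' [r' [nzb' nzp' BE]]]] := transv_of_trace dB tB B1.
move: (tA); rewrite {1}AE BE tr_mul_transv; set t := p * r' - r * p'.
move/addrI/oppr_inj; rewrite -!mulrA => /(mulfI nza) tE.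
have nzt : t != 0.
  by apply: contraNneq nzs2 => t0; rewrite -mulrA -tE t0 expr0n !mulr0.
(* The traces give [b' * t ^+ 2 = b * s ^+ 2]; the square by which [b'] and [b] differ is then
   absorbed by rescaling the vector. *)
have b'E : b' = b * (s / t) ^+ 2.
  by apply: (mulIf (expf_neq0 2 nzt)); rewrite tE; field.
exists p, r, (s / t * p'), (s / t * r'); split=> //.
  by rewrite !mulf_eq0 invr_eq0 (negPf nzs) (negPf nzt).
by rewrite AE BE b'E transv_scale.
Qed.

End Transvections.

(** * The product of two unipotent classes *)

Section ClassProduct.

Variables (F : finFieldType) (a b : F) (e1 e2 : {'GL_2[F]}).
Hypothesis oddF : odd #|F|.
Hypotheses (nza : a != 0) (nzb : b != 0) (nsq_ab : qchar (a * b) = -1).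
Hypotheses (e1_SL : e1 \in SL2 F) (e2_SL : e2 \in SL2 F).
Hypotheses (e1E : GLval e1 = transv a 1 0) (e2E : GLval e2 = transv b 1 0).
Implicit Types (A : 'M[F]_2) (x y : {'GL_2[F]}) (g : coset_of (pmI F)).

Let C1 := (coset (pmI F) e1 ^: PSL2 F)%g.
Let C2 := (coset (pmI F) e2 ^: PSL2 F)%g.

Let nz_ab : a * b != 0.
Proof. by rewrite mulf_neq0. Qed.

Lemma mem_class_product g : g \in (C1 * C2)%g <->
  exists x p r p' r', [/\ x \in SL2 F, (p != 0) || (r != 0),
    (p' != 0) || (r' != 0), GLval x = transv a p r * transv b p' r' &
    g = coset (pmI F) x].
Proof.
split=> [/mulsgP[g1 g2] | [x [p [r [p' [r' [xSL nz nz' xE ->]]]]]]].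
  case/(mem_class_std _ e1_SL e1E)=> x [p [r [xSL nz xE ->]]].
  case/(mem_class_std _ e2_SL e2E)=> y [p' [r' [ySL nz' yE ->]]] ->.
  exists (x * y)%g, p, r, p', r'; rewrite groupM // GL_ME xE yE.
  by rewrite morphM ?norm_pmI.
have [y ySL yE] := SL2_lift (det_transv a p r).
have [z zSL zE] := SL2_lift (det_transv b p' r').
have -> : x = (y * z)%g by apply: GLval_inj; rewrite GL_ME xE yE zE.
rewrite morphM ?norm_pmI // mem_mulg //.
  by apply/(mem_class_std _ e1_SL e1E); exists y, p, r.
by apply/(mem_class_std _ e2_SL e2E); exists z, p', r'.
Qed.

Lemma qchar_opp_ab : qchar (- (a * b)) = - qchar (-1).
Proof. by rewrite -[- (a * b)]mulN1r qcharM nsq_ab mulrN1. Qed.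

Lemma disc_SL2 A : \det A = 1 -> disc A = (\tr A - 2%:R) * (\tr A + 2%:R).
Proof. by rewrite /disc => ->; ring. Qed.

Lemma class_product_cases g : g \in (C1 * C2)%g ->
  [\/ g = 1%g /\ qchar (-1 : F) = -1, unipotent g |
      exists x, [/\ x \in SL2 F, g = coset (pmI F) x, disc (GLval x) != 0 &
        qchar (\tr (GLval x) - 2%:R) = - qchar (-1)]].
Proof.
case/mem_class_product=> x [p [r [p' [r' [xSL nz nz' xE ->]]]]].
have dx := det_SL2 xSL.
have tx : \tr (GLval x) = 2%:R - a * b * (p * r' - r * p') ^+ 2.
  by rewrite xE tr_mul_transv.
(* This expression vanishes when the two vectors are parallel; the product then has trace 2. *)
have [t0 | nzt] := eqVneq (p * r' - r * p') 0.
  rewrite t0 expr0n mulr0 subr0 in tx.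
  have [x1 | nx1] := eqVneq (GLval x) 1; last first.
    by apply: Or32; apply/unipotentP; exists x.
  apply: Or31; split; first by apply/eqP; rewrite coset_pmI_eq1 x1 eqxx.
  have eq_t : transv b p' r' = transv (- a) p r.
    by rewrite -[RHS]mulr1 -[1 in RHS]x1 xE mulrA transvM addNr transv0 mul1r.
  have [_ ep er _] := mx2_inj eq_t.
  (* Two inverse transvections make [- (a * b)] a square; as [a * b] is a nonsquare, so is -1. *)
  have sq s s' : s' != 0 -> b * s' ^+ 2 = - a * s ^+ 2 -> qchar (-1 : F) = -1.
    move=> nzs' e; have nzs : s != 0.
      apply: contraNneq (mulf_neq0 nzb (expf_neq0 2 nzs')).
      by rewrite e => ->; rewrite expr0n /= mulr0.
    have: qchar ((b * s') ^+ 2) = qchar (- (a * b)).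
      have -> : (b * s') ^+ 2 = - (a * b) * s ^+ 2.
        by rewrite exprMn expr2 -mulrA e; ring.
      by rewrite qcharM (qchar_sqr oddF nzs) mulr1.
    rewrite (qchar_sqr oddF) ?mulf_neq0 // qchar_opp_ab => q1.
    by apply: oppr_inj; rewrite opprK.
  case/orP: nz' => nz'; first exact: sq nz' ep.
  by apply: (sq r r') => //; apply: oppr_inj; rewrite -!mulNr.
apply: Or33; exists x; set t := p * r' - r * p' in tx nzt.
have T2 : \tr (GLval x) - 2%:R = - (a * b) * t ^+ 2 by rewrite tx; ring.
have qT2 : qchar (\tr (GLval x) - 2%:R) = - qchar (-1).
  by rewrite T2 qcharM (qchar_sqr oddF nzt) mulr1 qchar_opp_ab.
split=> //; rewrite disc_SL2 // T2 !mulf_neq0 ?oppr_eq0 ?expf_neq0 //.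
(* Trace -2 would make [a * b] the square of [2%:R / t]. *)
rewrite tx; apply/eqP=> e.
have ab : a * b = (2%:R / t) ^+ 2.
  have -> : a * b = a * b * t ^+ 2 / t ^+ 2 by field.
  have -> : a * b * t ^+ 2 = 2%:R ^+ 2.
    by apply/eqP; rewrite -subr_eq0 -oppr_eq0 -e; apply/eqP; ring.
  by field.
by apply: (@qcharN1_neq_sqr _ oddF (2%:R / t)); rewrite -ab.
Qed.

(** Transvections along one line multiply by adding parameters, so it suffices to write the
    parameter as [a * s ^+ 2 + b * k ^+ 2] with [s] and [k] nonzero. *)
Lemma unipotent_class_product g : (3 < #|F|)%N ->
  unipotent g -> g \in (C1 * C2)%g.
Proof.
move=> F_gt3 /unipotentP[x [xSL x1 tx ->]].
have [c [p [r [nzc nz xE]]]] := transv_of_trace (det_SL2 xSL) tx x1.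
have [s [k [nzs nzk cE]]] :=
  binary_form_nonzero_coords oddF F_gt3 nza nzb nsq_ab nzc.
apply/mem_class_product; exists x, (s * p), (s * r), (k * p), (k * r).
split=> //; rewrite ?mulf_eq0 ?(negPf nzs) ?(negPf nzk) //.
by rewrite -!transv_scale transvM cE.
Qed.

(** Now [- (a * b)] is a square [s ^+ 2], and scaling the vector by [a / s] turns the parameter [b]
    into [- a], that of the inverse transvection. *)
Lemma one_class_product : qchar (-1 : F) = -1 -> 1%g \in (C1 * C2)%g.
Proof.
move=> qN1; have := qchar_opp_ab; rewrite qN1 opprK.
move=> /(qchar1_sqr oddF)[s nzs sE].
apply/mem_class_product; exists 1%g, 1, 0, (a / s), 0.
rewrite group1 oner_neq0 mulf_neq0 ?invr_eq0 ?morph1 //; split=> //.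
have -> : transv b (a / s) 0 = transv (b * (a / s) ^+ 2) 1 0.
  by rewrite transv_scale mulr1 mulr0.
have -> : b * (a / s) ^+ 2 = - a.
  have -> : b * (a / s) ^+ 2 = a * (a * b) / s ^+ 2 by field.
  by rewrite -[a * b]opprK sE; field.
by rewrite transvM subrr transv0.
Qed.

(** The second alternative is the first one for [- x], which has the same image and satisfies
    [\tr (- x) - 2 = - (\tr x + 2)]. *)
Lemma semisimple_class_product x :
    x \in SL2 F -> disc (GLval x) != 0 ->
    qchar (\tr (GLval x) - 2%:R) = - qchar (-1) \/
    qchar (\tr (GLval x) + 2%:R) = -1 ->
  coset (pmI F) x \in (C1 * C2)%g.
Proof.
have main y : y \in SL2 F -> disc (GLval y) != 0 ->
    qchar (\tr (GLval y) - 2%:R) = - qchar (-1) ->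
    coset (pmI F) y \in (C1 * C2)%g.
  move=> ySL nzd qT; set T := \tr (GLval y) in qT.
  have nzT : T - 2%:R != 0.
    by apply: contraNneq nzd => T0; rewrite disc_SL2 ?det_SL2 // T0 mul0r.
  have [s nzs sE] : exists2 s, s != 0 & (T - 2%:R) * - (a * b) = s ^+ 2.
    apply: (qchar1_sqr oddF); rewrite qcharM qT qchar_opp_ab mulrNN -qcharM.
    by rewrite mulrNN mulr1 /qchar expr1n.
  have [||||p [r [p' [r' [nz nz' yE]]]]] :=
      @transv_product _ oddF (GLval y) a b (s / (a * b)) nza nzb.
  - by rewrite mulf_neq0 ?invr_eq0.
  - exact: det_SL2.
  - rewrite -/T; have -> : a * b * (s / (a * b)) ^+ 2 = s ^+ 2 / (a * b).
      by field; rewrite nza nzb.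
    by rewrite -sE; field; rewrite nza nzb.
  - by [].
  by apply/mem_class_product; exists y, p, r, p', r'.
move=> xSL nzd [qT | qT]; first exact: main.
have [y ySL yE] := SL2_opp xSL.
rewrite -(coset_pmI_opp yE); apply: main; rewrite ?yE ?disc_opp //.
have -> : \tr (- GLval x) - 2%:R = -1 * (\tr (GLval x) + 2%:R).
  by rewrite raddfN /=; ring.
by rewrite qcharM qT mulrN1.
Qed.

End ClassProduct.

(** * Good order in terms of the trace *)

Section GoodOrder.

Variable F : finFieldType.
Hypothesis oddF : odd #|F|.
Implicit Types (x : {'GL_2[F]}).

Lemma trace_add2_neq0 x : x \in SL2 F -> disc (GLval x) != 0 ->
  \tr (GLval x) + 2%:R != 0.
Proof.
by move/det_SL2/disc_SL2=> -> nzd; apply: contraNneq nzd => ->; rewrite mulr0.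
Qed.

Lemma scalar_eq1 (k : F) : (k%:M : 'M[F]_2) = 1 <-> k = 1.
Proof.
by split=> [/matrixP/(_ 0 0) | -> //]; rewrite !mxE /= !mulr1n.
Qed.

Lemma qchar_neq0 (k : F) : qchar k != 0 -> k != 0.
Proof. by apply: contraNneq => ->; rewrite (qchar0 oddF). Qed.

(** The congruence makes [#|F| - 1] a multiple of 4, so good order means that the half power of [x],
    a scalar equal to the character of [\tr x + 2], is 1. The discriminant rules out the non-split
    clause. *)
Lemma good_order_split x : #|F| = 1 %[mod 4] -> x \in SL2 F ->
    qchar (disc (GLval x)) = 1 ->
  good_order #|F| (coset (pmI F) x) <-> qchar (\tr (GLval x) + 2%:R) = 1.
Proof.
move=> F1 xSL dx.
have nzd : disc (GLval x) != 0 by apply: qchar_neq0; rewrite dx oner_neq0.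
have T2 := trace_add2_neq0 xSL nzd.
have gm : good_mod #[coset (pmI F) x]%g (#|F| - 1) <->
    qchar (\tr (GLval x) + 2%:R) = 1.
  rewrite subn1 -scalar_eq1 -half_power_split ?det_SL2 //.
  have gt1 := card_gt1F F.
  apply: good_modP => //; [lia | lia |].
  rewrite -(half_card_predK oddF) exprM half_power_split ?det_SL2 //.
  rewrite -(rmorphXn (@scalar_mx F 2)) /=; apply/scalar_eq1.
  by case: (qchar_pm1 oddF T2) => ->; rewrite ?sqrrN expr1n.
split=> [[[_ /gm] // | [/nonsplit_semisimpleP]] | /gm]; last first.
  by move=> gx; left; split=> //; apply/(split_semisimpleP oddF xSL).
move=> /(_ oddF xSL); rewrite dx => /eqP.
by rewrite (negPf (neq_opp1 oddF)).
Qed.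

Lemma good_order_nonsplit x : #|F| = 3 %[mod 4] -> x \in SL2 F ->
    qchar (disc (GLval x)) = -1 ->
  good_order #|F| (coset (pmI F) x) <-> qchar (\tr (GLval x) + 2%:R) = 1.
Proof.
move=> F3 xSL dx.
have nzd : disc (GLval x) != 0.
  by apply: qchar_neq0; rewrite dx oppr_eq0 oner_neq0.
have T2 := trace_add2_neq0 xSL nzd.
have gm : good_mod #[coset (pmI F) x]%g (#|F| + 1) <->
    qchar (\tr (GLval x) + 2%:R) = 1.
  rewrite addn1 -scalar_eq1 -half_power_nonsplit ?det_SL2 //.
  apply: good_modP => //; [lia |].
  have -> : #|F|.+1 = ((#|F|.+1)./2 * 2)%N by move: oddF; lia.
  rewrite exprM half_power_nonsplit ?det_SL2 //.
  rewrite -(rmorphXn (@scalar_mx F 2)) /=; apply/scalar_eq1.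
  by case: (qchar_pm1 oddF T2) => ->; rewrite ?sqrrN expr1n.
split=> [[[/split_semisimpleP] | [_ /gm] //] | /gm]; last first.
  by move=> gx; right; split=> //; apply/(nonsplit_semisimpleP oddF xSL).
move=> /(_ oddF xSL); rewrite dx => /eqP.
by rewrite eq_sym (negPf (neq_opp1 oddF)).
Qed.

End GoodOrder.

(** * Distinct unipotent classes and the two congruence cases *)

Lemma distinct_classes_std (F : finFieldType) (C1 C2 : {set coset_of (pmI F)}) :
    odd #|F| -> unipotent_class C1 -> unipotent_class C2 -> C1 <> C2 ->
  exists a b e1 e2, [/\ [/\ a != 0, b != 0 & qchar (a * b) = -1],
    e1 \in SL2 F /\ e2 \in SL2 F,
    GLval e1 = transv a 1 0 /\ GLval e2 = transv b 1 0,
    C1 = (coset (pmI F) e1 ^: PSL2 F)%g &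
    C2 = (coset (pmI F) e2 ^: PSL2 F)%g].
Proof.
move=> oddF /unipotent_class_std[a [e1 [nza e1SL e1E C1E]]].
move=> /unipotent_class_std[b [e2 [nzb e2SL e2E C2E]]] neqC.
exists a, b, e1, e2; split=> //; split=> //.
have nzab : a * b != 0 by rewrite mulf_neq0.
(* If [a * b] were a square [s ^+ 2], then [b * (a / s) ^+ 2 = a] and the classes would coincide. *)
case: (qchar_pm1 oddF nzab) => // /(qchar1_sqr oddF)[s nzs sE].
case: neqC; rewrite C1E C2E; apply: class_eqP.
apply/(mem_class_std _ e2SL e2E); exists e1, (a / s), 0; split=> //.
  by rewrite mulf_neq0 ?invr_eq0.
rewrite -[a / s]mulr1 -(mulr0 (a / s)) -transv_scale e1E; congr transv.
have -> : b * (a / s) ^+ 2 = a * (a * b) / s ^+ 2 by field.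
by rewrite sE; field.
Qed.

Section DistinctClasses.

Variables (F : finFieldType) (C1 C2 : {set coset_of (pmI F)}).
Hypotheses (oddF : odd #|F|) (F_gt3 : (3 < #|F|)%N).
Hypotheses (uC1 : unipotent_class C1) (uC2 : unipotent_class C2).
Hypothesis neqC : C1 <> C2.
Implicit Types (x : {'GL_2[F]}) (g : coset_of (pmI F)).

Let neq1 : (1 : F) <> -1.
Proof. exact/eqP/neq_opp1. Qed.

Lemma qchar_disc x : x \in SL2 F -> qchar (disc (GLval x)) =
  qchar (\tr (GLval x) - 2%:R) * qchar (\tr (GLval x) + 2%:R).
Proof. by move=> /det_SL2/disc_SL2->; rewrite qcharM. Qed.

Let disc_neq0 x e : qchar (disc (GLval x)) = e -> e != 0 ->
  disc (GLval x) != 0.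
Proof. by move=> <-; apply: qchar_neq0. Qed.

Let one0 := oner_neq0 F.
Let N10 : (-1 : F) != 0. Proof. by rewrite oppr_eq0. Qed.

Let qT2 x : x \in SL2 F -> disc (GLval x) != 0 ->
  qchar (\tr (GLval x) + 2%:R) = 1 \/ qchar (\tr (GLval x) + 2%:R) = -1.
Proof. by move=> xSL nzd; apply/(qchar_pm1 oddF)/trace_add2_neq0. Qed.

(** Here -1 is a square, so membership asks for [T - 2] or [T + 2] to be a nonsquare. In the
    non-split case their characters differ, so one of them is -1; in the split case they agree, and
    both are -1 exactly for bad order. *)
Lemma class_product_mod1 g : #|F| = 1 %[mod 4] ->
  g \in (C1 * C2)%g <->
    [\/ unipotent g, nonsplit_semisimple g |
        split_semisimple g /\ bad_order #|F| g].
Proof.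
move=> Fmod.
have [a [b [e1 [e2 [[nza nzb nsq] [e1SL e2SL] [e1E e2E] -> ->]]]]] :=
  distinct_classes_std oddF uC1 uC2 neqC.
have cases := class_product_cases oddF nza nzb nsq e1SL e2SL e1E e2E.
have uniI := unipotent_class_product oddF nza nzb nsq e1SL e2SL e1E e2E.
have ssI := semisimple_class_product oddF nza nzb nsq e1SL e2SL e1E e2E.
have qN1 := qchar_opp1_mod1 oddF Fmod; rewrite qN1 in cases ssI.
split=> [/cases[[_ /neq1] // | ug | [x [xSL -> nzd qx]]] | ].
- exact: Or31.
- case: (qchar_pm1 oddF nzd) => dx; last first.
    exact/Or32/(nonsplit_semisimpleP oddF xSL).
  apply: Or33; split; first exact/(split_semisimpleP oddF xSL).
  split; first exact: semisimple_coset.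
  move/(good_order_split oddF Fmod xSL dx) => gx.
  by move: dx; rewrite qchar_disc // qx gx mulr1 => /esym.
case=> [ug | [x [xSL xZ ss irr gE]] | [[x [xSL xZ ss diag gE]] [_ bad]]].
- exact: uniI.
- have dx : qchar (disc (GLval x)) = -1 by apply/(irreducible_char_polyP oddF).
  have nzd := disc_neq0 dx N10; rewrite gE; apply: ssI => //.
  case: (qT2 xSL nzd) => q2; [left | by right].
  by move: dx; rewrite qchar_disc // q2 mulr1.
have dx : qchar (disc (GLval x)) = 1.
  by apply/(split_semisimpleP oddF xSL); exists x.
have nzd := disc_neq0 dx one0; rewrite gE in bad *; apply: ssI => //.
case: (qT2 xSL nzd) => q2; [case: bad | by right].
exact/(good_order_split oddF Fmod xSL dx).
Qed.

(** Here -1 is a nonsquare, so membership asks for [T - 2] to be a square or [T + 2] a nonsquare.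
    Equal characters, the split case, always allow this; opposite ones do so exactly when [T + 2]
    has character -1, that is, for bad order. *)
Lemma class_product_mod3 g : #|F| = 3 %[mod 4] ->
  g \in (C1 * C2)%g <->
    [\/ unipotent g, split_semisimple g,
        nonsplit_semisimple g /\ bad_order #|F| g | g = 1%g].
Proof.
move=> Fmod.
have [a [b [e1 [e2 [[nza nzb nsq] [e1SL e2SL] [e1E e2E] -> ->]]]]] :=
  distinct_classes_std oddF uC1 uC2 neqC.
have cases := class_product_cases oddF nza nzb nsq e1SL e2SL e1E e2E.
have uniI := unipotent_class_product oddF nza nzb nsq e1SL e2SL e1E e2E.
have ssI := semisimple_class_product oddF nza nzb nsq e1SL e2SL e1E e2E.
have oneI := one_class_product oddF nza nsq e1SL e2SL e1E e2E.
have qN1 := qchar_opp1_mod3 oddF Fmod; rewrite qN1 in cases ssI oneI.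
rewrite opprK in cases ssI.
split=> [/cases[[-> _] | ug | [x [xSL -> nzd qx]]] | ].
- exact: Or44.
- exact: Or41.
- case: (qchar_pm1 oddF nzd) => dx.
    exact/Or42/(split_semisimpleP oddF xSL).
  apply: Or43; split; first exact/(nonsplit_semisimpleP oddF xSL).
  split; first exact: semisimple_coset.
  move/(good_order_nonsplit oddF Fmod xSL dx) => gx.
  by move: dx; rewrite qchar_disc // qx gx mulr1.
case=> [ug | [x [xSL xZ ss diag gE]] | [[x [xSL xZ ss irr gE]] [_ bad]] | ->].
- exact: uniI.
- have dx : qchar (disc (GLval x)) = 1.
    by apply/(split_semisimpleP oddF xSL); exists x.
  have nzd := disc_neq0 dx one0; rewrite gE; apply: ssI => //.
  case: (qT2 xSL nzd) => q2; [left | by right].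
  by move: dx; rewrite qchar_disc // q2 mulr1.
- have dx : qchar (disc (GLval x)) = -1 by apply/(irreducible_char_polyP oddF).
  have nzd := disc_neq0 dx N10; rewrite gE in bad *; apply: ssI => //.
  case: (qT2 xSL nzd) => q2; [case: bad | by right].
  exact/(good_order_nonsplit oddF Fmod xSL dx).
exact: oneI.
Qed.

End DistinctClasses.

Local Close Scope ring_scope.
Unset Implicit Arguments.

Theorem theorem3p20 (F : finFieldType) (q : nat)
    (cardF : #|F| = q) (q_odd : odd q) (q_gt3 : 3 < q)
    (C1 C2 : {set coset_of (pmI F)})
    (uC1 : unipotent_class C1) (uC2 : unipotent_class C2) (neqC : C1 <> C2) :
  (q = 1 %[mod 4] ->
     forall g : coset_of (pmI F),
       g \in (C1 * C2)%g <->
         [\/ unipotent g,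
             nonsplit_semisimple g |
             split_semisimple g /\ bad_order q g])
  /\
  (q = 3 %[mod 4] ->
     forall g : coset_of (pmI F),
       g \in (C1 * C2)%g <->
         [\/ unipotent g,
             split_semisimple g,
             nonsplit_semisimple g /\ bad_order q g |
             g = 1%g]).
Proof.
subst q; split=> Fmod g; first exact: class_product_mod1.
exact: class_product_mod3.
Qed.
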